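(* Let $\Bbbk$ be a field. Let $S$ be a finite semigroup, let $E$ be a set of idempotents of $S$, and assume that $S$ is a reduced $E$-Fountain semigroup which satisfies the congruence condition and the generalized right ample identity. Assume that the relation $\trianglelefteq_{l}$ on $S$ is contained in a partial order. Then there is an isomorphism of $\Bbbk$-linear categories $\Bbbk[\mathcal{C}(S)]^{\mathrm{op}}\simeq\mathcal{L}(\Bbbk S)$.
   Context: For a semigroup $S$ and a subset $E$ of idempotents of $S$, define equivalence relations on $S$: $a\,\widetilde{\mathcal{L}}_E\,b$ iff for all $e\in E$ ($ae=a\iff be=b$); $a\,\widetilde{\mathcal{R}}_E\,b$ iff for all $e\in E$ ($ea=a\iff eb=b$). $S$ is $E$-Fountain if every $\widetilde{\mathcal{L}}_E$-class and every $\widetilde{\mathcal{R}}_E$-class contains an element of $E$. It is reduced if moreover $ef=e\iff fe=e$ for all $e,f\in E$. In that case each $\widetilde{\mathcal{L}}_E$-class (resp. $\widetilde{\mathcal{R}}_E$-class) contains a unique element of $E$; the one in the $\widetilde{\mathcal{L}}_E$-class (resp. $\widetilde{\mathcal{R}}_E$-class) of $a\in S$ is denoted $a^{\ast}$ (resp. $a^{+}$). $S$ satisfies the congruence condition if $\widetilde{\mathcal{L}}_E$ is a right congruence and $\widetilde{\mathcal{R}}_E$ is a left congruence; equivalently $(ab)^{\ast}=(a^{\ast}b)^{\ast}$ and $(ab)^{+}=(ab^{+})^{+}$ for all $a,b\in S$. The generalized right ample identity holds in $S$ if $\left(e\left(a(eaf)^{\ast}\right)^{+}\right)^{\ast}=\left(a(eaf)^{\ast}\right)^{+}$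 for all $a\in S$ and $e,f\in E$. The relation $\trianglelefteq_{l}$ on $S$: $a\trianglelefteq_{l}b$ iff $a=be$ for some $e\in E$. The category $\mathcal{C}(S)$: its objects are the elements of $E$; its morphisms are in one-to-one correspondence with elements of $S$, where $a\in S$ corresponds to a morphism $C(a)$ with domain $a^{\ast}$ and range $a^{+}$; if $b^{\ast}=a^{+}$ the composition is $C(b)\cdot C(a)=C(ba)$. A $\Bbbk$-linear category is a category enriched over $\Bbbk$-vector spaces (hom-sets are $\Bbbk$-vector spaces and composition is bilinear); a functor of $\Bbbk$-linear categories is a functor that is linear on each hom-set. For a category $\mathcal{C}$, $\Bbbk[\mathcal{C}]$ is the $\Bbbk$-linear category with the same objects, whose hom-space from $e$ to $f$ has basis $\mathcal{C}(e,f)$ and whose composition is the bilinear extension of that of $\mathcal{C}$. For $e\in E$, $\widetilde{\mathcal{L}}_E(e)$ is the $\widetilde{\mathcal{L}}_E$-class of $e$, and $\Bbbk\widetilde{\mathcal{L}}_E(e)$ is the $\Bbbk$-vector space with basis $\widetilde{\mathcal{L}}_E(e)$, a left module over the semigroup algebra $\Bbbk S$ via the linear extension of: $s\cdot x=sx$ if $sx\in\widetilde{\mathcal{L}}_E(e)$, and $s\cdot x=0$ otherwise. $\mathcal{L}(\Bbbk S)$ is the $\Bbbk$-linear category whose objects are the modules $\Bbbk\widetilde{\mathcal{L}}_E(e)$ for $e\in E$, and whose hom-space from $\Bbbk\widetilde{\mathcal{L}}_E(e)$ to $\Bbbk\widetilde{\mathcal{L}}_E(f)$ is $\mathrm{Hom}_{\Bbbk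 S}(\Bbbk\widetilde{\mathcal{L}}_E(e),\Bbbk\widetilde{\mathcal{L}}_E(f))$, with the usual composition. *)

(* Defs.v *)
From HB Require Import structures.
From mathcomp Require Import all_boot all_order all_algebra.
From mathcomp Require Import boolp.

Set Implicit Arguments.
Unset Strict Implicit.
Unset Printing Implicit Defensive.

Import GRing.Theory.
Local Open Scope ring_scope.

#[short(type="finSemigroupType")]
HB.structure Definition FinSemigroup := {S of Semigroup S & Finite S}.

Section Fountain.
Variables (S : finSemigroupType) (E : {set S}).
Implicit Types a b c e f : S.
Local Open Scope group_scope.

Definition Ltilde : rel S :=
  fun a b => [forall e in E, (a * e == a) == (b * e == b)].
Definition Rtilde : rel S :=
  fun a b => [forall e in E, (e * a == a) == (e * b == b)].

Definition set_of_idempotents := forall e, e \in E -> e * e = e.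

Definition E_Fountain :=
  (forall a, exists2 e, e \in E & Ltilde a e) /\
  (forall a, exists2 e, e \in E & Rtilde a e).

Definition reduced_E_Fountain :=
  E_Fountain /\ forall e f, e \in E -> f \in E -> (e * f = e <-> f * e = e).

Definition congruence_condition :=
  (forall a b c, Ltilde a b -> Ltilde (a * c) (b * c)) /\
  (forall a b c, Rtilde a b -> Rtilde (c * a) (c * b)).

(* The default value is never reached when S is E-Fountain, and the idempotent
   picked is the only possible one when S is moreover reduced: see [star_uniq]
   and [plus_uniq]. *)
Definition star a : S := odflt a [pick e in E | Ltilde a e].
Definition plus a : S := odflt a [pick e in E | Rtilde a e].

Definition generalized_right_ample :=
  forall a e f, e \in E -> f \in E ->
  star (e * plus (a * star (e * a * f))) = plus (a * star (e * a * f)).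

Definition trianglelefteq_l a b := exists2 e, e \in E & a = b * e.

Lemma LtildeP a b :
  reflect (forall e, e \in E -> (a * e = a <-> b * e = b)) (Ltilde a b).
Proof.
apply: (iffP forall_inP) => H e eE.
  by have /eqP h := H e eE; split=> /eqP; [rewrite h | rewrite -h] => /eqP.
by apply/eqP; apply/idP/idP=> /eqP/(H e eE)/eqP.
Qed.

Lemma RtildeP a b :
  reflect (forall e, e \in E -> (e * a = a <-> e * b = b)) (Rtilde a b).
Proof.
apply: (iffP forall_inP) => H e eE.
  by have /eqP h := H e eE; split=> /eqP; [rewrite h | rewrite -h] => /eqP.
by apply/eqP; apply/idP/idP=> /eqP/(H e eE)/eqP.
Qed.

Lemma Ltilde_refl a : Ltilde a a. Proof. by apply/LtildeP. Qed.
Lemma Rtilde_refl a : Rtilde a a. Proof. by apply/RtildeP. Qed.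

Lemma Ltilde_sym a b : Ltilde a b -> Ltilde b a.
Proof. by move=> /LtildeP H; apply/LtildeP=> e /H[]. Qed.

Lemma Rtilde_sym a b : Rtilde a b -> Rtilde b a.
Proof. by move=> /RtildeP H; apply/RtildeP=> e /H[]. Qed.

Lemma Ltilde_trans b a c : Ltilde a b -> Ltilde b c -> Ltilde a c.
Proof.
move=> /LtildeP H /LtildeP K; apply/LtildeP=> e eE.
exact: iff_trans (H e eE) (K e eE).
Qed.

Lemma Rtilde_trans b a c : Rtilde a b -> Rtilde b c -> Rtilde a c.
Proof.
move=> /RtildeP H /RtildeP K; apply/RtildeP=> e eE.
exact: iff_trans (H e eE) (K e eE).
Qed.

Section Theory.
Hypotheses (idemE : set_of_idempotents) (fountE : reduced_E_Fountain).

Lemma starP a : star a \in E /\ Ltilde a (star a).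
Proof.
rewrite /star; case: pickP => [e /andP[] //|/=].
by have [[+ _] _] := fountE => /(_ a)[e eE ae] /(_ e); rewrite eE ae.
Qed.

Lemma plusP a : plus a \in E /\ Rtilde a (plus a).
Proof.
rewrite /plus; case: pickP => [e /andP[] //|/=].
by have [[_ +] _] := fountE => /(_ a)[e eE ae] /(_ e); rewrite eE ae.
Qed.

Lemma star_uniq a e : e \in E -> Ltilde a e -> e = star a.
Proof.
move=> eE ae; have [sE as_] := starP a; have [_ red] := fountE.
have /LtildeP es := Ltilde_trans (Ltilde_sym ae) as_.
have ees : e * star a = e by apply/es; rewrite ?idemE.
have /red <- // : star a * e = star a by apply/es; rewrite ?idemE.
Qed.

Lemma plus_uniq a e : e \in E -> Rtilde a e -> e = plus a.
Proof.
move=> eE ae; have [sE as_] := plusP a; have [_ red] := fountE.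
have /RtildeP es := Rtilde_trans (Rtilde_sym ae) as_.
have ees : plus a * e = e by apply/es; rewrite ?idemE.
have ess : e * plus a = plus a by apply/es; rewrite ?idemE.
by rewrite -ess; apply/esym/red.
Qed.

Lemma star_id e : e \in E -> star e = e.
Proof. by move=> eE; rewrite -(star_uniq eE (Ltilde_refl e)). Qed.

Lemma plus_id e : e \in E -> plus e = e.
Proof. by move=> eE; rewrite -(plus_uniq eE (Rtilde_refl e)). Qed.

Lemma mul_star a : a * star a = a.
Proof. by have [sE /LtildeP/(_ _ sE)[_]] := starP a; apply; apply: idemE. Qed.

Lemma plus_mul a : plus a * a = a.
Proof. by have [sE /RtildeP/(_ _ sE)[_]] := plusP a; apply; apply: idemE. Qed.

Lemma Ltilde_mull e a b :
  e \in E -> Ltilde (b * a) e -> a * e = a -> Ltilde a e.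
Proof.
move=> eE /LtildeP bae ae; have [_ red] := fountE.
have [sE as_] := starP a.
have es : e * star a = e by apply/bae; rewrite // -mulgA mul_star.
have se : star a * e = star a by have /LtildeP/(_ e eE)[h _] := as_; apply: h.
have ses : e * star a = star a by apply/red.
by rewrite -es ses.
Qed.

Section Congruence.
Hypothesis congE : congruence_condition.

Lemma starM a b : star (a * b) = star (star a * b).
Proof.
have [lc _] := congE; have [_ h] := starP a; have [sE h'] := starP (a * b).
by apply: star_uniq => //; apply: Ltilde_trans h'; apply/Ltilde_sym/lc.
Qed.

Lemma plusM a b : plus (a * b) = plus (a * plus b).
Proof.
have [_ rc] := congE; have [_ h] := plusP b; have [sE h'] := plusP (a * b).
by apply: plus_uniq => //; apply: Rtilde_trans h'; apply/Rtilde_sym/rc.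
Qed.

End Congruence.
End Theory.
End Fountain.

(* Homomorphism sets are finite, so that the vector space with basis
   [fhom x y] is [{ffun fhom x y -> k^o}]. *)
Record fincat := FinCat {
  fob : Type;
  fhom : fob -> fob -> finType;
  fid : forall x, fhom x x;
  fcomp : forall x y z, fhom y z -> fhom x y -> fhom x z;
  fcompA : forall x y z t (h : fhom z t) (g : fhom y z) (f : fhom x y),
    fcomp h (fcomp g f) = fcomp (fcomp h g) f;
  fcomp1l : forall x y (f : fhom x y), fcomp (fid y) f = f;
  fcomp1r : forall x y (f : fhom x y), fcomp f (fid x) = f
}.

Section CS.
Variables (S : finSemigroupType) (E : {set S}).
Hypotheses (idemE : set_of_idempotents E) (fountE : reduced_E_Fountain E).
Hypothesis congE : congruence_condition E.
Local Open Scope group_scope.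

Definition CS_ob : Type := {e : S | e \in E}.
Definition CS_hom (e f : CS_ob) : finType :=
  {a : S | (star E a == val e) && (plus E a == val f)}.

Fact CS_id_subproof (e : CS_ob) :
  (star E (val e) == val e) && (plus E (val e) == val e).
Proof. by rewrite star_id ?plus_id ?eqxx ?(valP e). Qed.

Definition CS_id e : CS_hom e e := Sub (val e) (CS_id_subproof e).

Fact CS_comp_subproof e f g (b : CS_hom f g) (a : CS_hom e f) :
  (star E (val b * val a) == val e) && (plus E (val b * val a) == val g).
Proof.
move: (val b) (valP b) (val a) (valP a) => {}b /andP[/eqP sb /eqP pb].
move=> {}a /andP[/eqP sa /eqP pa].
by rewrite starM // sb -pa plus_mul // sa plusM // pa -sb mul_star // pb !eqxx.
Qed.

Definition CS_comp e f g (b : CS_hom f g) (a : CS_hom e f) : CS_hom e g :=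
  Sub (val b * val a) (CS_comp_subproof b a).

Fact CS_compA e f g h (c : CS_hom g h) (b : CS_hom f g) (a : CS_hom e f) :
  CS_comp c (CS_comp b a) = CS_comp (CS_comp c b) a.
Proof. by apply: val_inj; rewrite /= mulgA. Qed.

Fact CS_comp1l e f (a : CS_hom e f) : CS_comp (CS_id f) a = a.
Proof.
apply: val_inj; have /andP[_ /eqP pa] := valP a.
by have := plus_mul idemE fountE (val a); rewrite pa.
Qed.

Fact CS_comp1r e f (a : CS_hom e f) : CS_comp a (CS_id e) = a.
Proof.
apply: val_inj; have /andP[/eqP sa _] := valP a.
by have := mul_star idemE fountE (val a); rewrite sa.
Qed.

Definition CS : fincat := FinCat CS_compA CS_comp1l CS_comp1r.

End CS.

Record lincat (k : fieldType) := LinCat {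
  lob : Type;
  lhom : lob -> lob -> lmodType k;
  lid : forall x, lhom x x;
  lcomp : forall x y z, lhom y z -> lhom x y -> lhom x z;
  lcompA : forall x y z t (h : lhom z t) (g : lhom y z) (f : lhom x y),
    lcomp h (lcomp g f) = lcomp (lcomp h g) f;
  lcomp1l : forall x y (f : lhom x y), lcomp (lid y) f = f;
  lcomp1r : forall x y (f : lhom x y), lcomp f (lid x) = f;
  lcomp_linearl : forall x y z (f : lhom x y),
    linear (fun g : lhom y z => lcomp g f);
  lcomp_linearr : forall x y z (g : lhom y z),
    linear (fun f : lhom x y => lcomp g f)
}.

Definition lop (k : fieldType) (C : lincat k) : lincat k :=
  @LinCat k (lob C) (fun x y => lhom y x) (fun x => lid x)
    (fun x y z g f => lcomp f g)
    (fun x y z t h g f => esym (lcompA f g h))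
    (fun x y f => lcomp1r f) (fun x y f => lcomp1l f)
    (fun x y z f => @lcomp_linearr k C z y x f)
    (fun x y z g => @lcomp_linearl k C z y x g).

Record linfunctor (k : fieldType) (C D : lincat k) := LinFunctor {
  lF0 :> lob C -> lob D;
  lF1 : forall x y, lhom x y -> lhom (lF0 x) (lF0 y);
  lF1_linear : forall x y, linear (@lF1 x y);
  lF1_id : forall x, lF1 (lid x) = lid (lF0 x);
  lF1_comp : forall x y z (g : lhom y z) (f : lhom x y),
    lF1 (lcomp g f) = lcomp (lF1 g) (lF1 f)
}.

Definition lincat_iso (k : fieldType) (C D : lincat k) : Prop :=
  exists F : linfunctor C D,
    bijective (lF0 F) /\ forall x y, bijective (@lF1 k C D F x y).

Section Free.
Variable k : fieldType.

Definition basis (T : finType) (x : T) : {ffun T -> k^o} :=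
  [ffun y => (y == x)%:R].

(* The bilinear extension of a map defined on pairs of basis vectors. *)
Definition bilin_ext (T1 T2 : finType) (V : lmodType k) (m : T1 -> T2 -> V)
    (u : {ffun T1 -> k^o}) (v : {ffun T2 -> k^o}) : V :=
  \sum_x \sum_y (u x * v y : k) *: m x y.

Lemma basis_sum (T : finType) (u : {ffun T -> k^o}) :
  u = \sum_x (u x : k) *: basis x.
Proof.
apply/ffunP=> y; rewrite sum_ffunE (bigD1 y) //= big1 => [|x xy].
  by rewrite !ffunE eqxx addr0 /GRing.scale /= mulr1.
by rewrite !ffunE eq_sym (negPf xy) scaler0.
Qed.

Section Bilin.
Variables (T1 T2 : finType) (V : lmodType k) (m : T1 -> T2 -> V).

Lemma bilin_ext_linearl v : linear (fun u => bilin_ext m u v).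
Proof.
move=> c u u'; rewrite /bilin_ext scaler_sumr -big_split; apply: eq_bigr => x _.
rewrite scaler_sumr -big_split; apply: eq_bigr => y _.
by rewrite !ffunE -[c *: u x]/(c * u x) mulrDl scalerDl -mulrA scalerA.
Qed.

Lemma bilin_ext_linearr u : linear (bilin_ext m u).
Proof.
move=> c v v'; rewrite /bilin_ext scaler_sumr -big_split; apply: eq_bigr => x _.
rewrite scaler_sumr -big_split; apply: eq_bigr => y _.
by rewrite !ffunE -[c *: v y]/(c * v y) mulrDr scalerDl mulrCA scalerA.
Qed.

Lemma bilin_ext_basis x y : bilin_ext m (basis x) (basis y) = m x y.
Proof.
rewrite /bilin_ext (bigD1 x) //= [X in _ + X]big1 ?addr0 => [|x' xx']; last first.
  by rewrite big1 // => y' _; rewrite !ffunE (negPf xx') mul0r scale0r.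
rewrite (bigD1 y) //= big1 ?addr0 => [|y' yy'].
  by rewrite !ffunE !eqxx mulr1 scale1r.
by rewrite !ffunE (negPf yy') mulr0 scale0r.
Qed.

Lemma bilin_ext_suml I r (c : I -> k) (F : I -> {ffun T1 -> k^o}) v :
  bilin_ext m (\sum_(i <- r) c i *: F i) v =
  \sum_(i <- r) c i *: bilin_ext m (F i) v.
Proof.
pose L : {linear _ -> V} := HB.pack (fun u => bilin_ext m u v)
  (GRing.isLinear.Build k _ V _ _ (bilin_ext_linearl v)).
rewrite -[LHS]/(L _) linear_sum; apply: eq_bigr => i _; by rewrite linearZ_LR.
Qed.

Lemma bilin_ext_sumr I r (c : I -> k) (F : I -> {ffun T2 -> k^o}) u :
  bilin_ext m u (\sum_(i <- r) c i *: F i) =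
  \sum_(i <- r) c i *: bilin_ext m u (F i).
Proof.
pose L : {linear _ -> V} := HB.pack (bilin_ext m u)
  (GRing.isLinear.Build k _ V _ _ (bilin_ext_linearr u)).
rewrite -[LHS]/(L _) linear_sum; apply: eq_bigr => i _; by rewrite linearZ_LR.
Qed.

End Bilin.

Lemma bilin_extA (T1 T2 T3 T12 T23 : finType) (V : lmodType k)
    (m12 : T1 -> T2 -> {ffun T12 -> k^o}) (m12_3 : T12 -> T3 -> V)
    (m23 : T2 -> T3 -> {ffun T23 -> k^o}) (m1_23 : T1 -> T23 -> V) :
  (forall x y z, bilin_ext m12_3 (m12 x y) (basis z) =
                 bilin_ext m1_23 (basis x) (m23 y z)) ->
  forall u v w, bilin_ext m12_3 (bilin_ext m12 u v) w =
                bilin_ext m1_23 u (bilin_ext m23 v w).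
Proof.
move=> H u v w; rewrite [u]basis_sum !bilin_ext_suml.
apply: eq_bigr => x _; congr (_ *: _).
rewrite [v]basis_sum (bilin_ext_sumr m12) !bilin_ext_suml bilin_ext_sumr.
apply: eq_bigr => y _; congr (_ *: _).
rewrite [w]basis_sum !bilin_ext_sumr.
apply: eq_bigr => z _; congr (_ *: _).
by rewrite !bilin_ext_basis.
Qed.

End Free.

Section Linearization.
Variables (k : fieldType) (C : fincat).

Definition lin_hom (x y : fob C) : lmodType k := {ffun fhom x y -> k^o}.
Definition lin_id x : lin_hom x x := basis k (fid x).
Definition lin_comp x y z : lin_hom y z -> lin_hom x y -> lin_hom x z :=
  bilin_ext (fun g f => basis k (fcomp g f)).

Fact lin_compA x y z t (h : lin_hom z t) (g : lin_hom y z) (f : lin_hom x y) :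
  lin_comp h (lin_comp g f) = lin_comp (lin_comp h g) f.
Proof. by apply/esym/bilin_extA => *; rewrite !bilin_ext_basis fcompA. Qed.

Fact lin_comp1l x y (f : lin_hom x y) : lin_comp (lin_id y) f = f.
Proof.
rewrite [in LHS](basis_sum f) /lin_comp bilin_ext_sumr [RHS]basis_sum.
by apply: eq_bigr => i _; rewrite bilin_ext_basis fcomp1l.
Qed.

Fact lin_comp1r x y (f : lin_hom x y) : lin_comp f (lin_id x) = f.
Proof.
rewrite [in LHS](basis_sum f) /lin_comp bilin_ext_suml [RHS]basis_sum.
by apply: eq_bigr => i _; rewrite bilin_ext_basis fcomp1r.
Qed.

Definition linearization : lincat k :=
  LinCat lin_compA lin_comp1l lin_comp1r
    (fun x y z f => bilin_ext_linearl _ f) (fun x y z g => bilin_ext_linearr _ g).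

End Linearization.

Section SemigroupAlgebra.
Variables (k : fieldType) (S : finSemigroupType).

Definition salg := {ffun S -> k^o}.
Definition salg_mul : salg -> salg -> salg :=
  bilin_ext (fun s t => basis k (s * t)%g).

(* The algebra kS need not have a unit, so modules are not required to be
   unital. *)
Record salg_module := SalgModule {
  scarrier :> vectType k;
  sact : salg -> scarrier -> scarrier;
  sact_linearl : forall v, linear (fun a => sact a v);
  sact_linearr : forall a, linear (sact a);
  sact_mul : forall a b v, sact (salg_mul a b) v = sact a (sact b v)
}.

Section Hom.
Variables M N : salg_module.

Definition salg_equivariant : {pred 'Hom(M, N)} :=
  fun f => `[< forall a v, f (sact a v) = sact a (f v) >].

Record salg_hom := SalgHom {
  salg_hom_val :> 'Hom(M, N);
  _ : salg_hom_val \in salg_equivariant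
}.

HB.instance Definition _ := [isSub for salg_hom_val].
HB.instance Definition _ := [Choice of salg_hom by <:].

Fact salg_equivariant_submod : submod_closed salg_equivariant.
Proof.
split=> [|c f g /asboolP Hf /asboolP Hg]; apply/asboolP=> a v.
  have := sact_linearr a (-1) (0 : N) 0.
  by rewrite scaler0 addr0 scaleN1r addNr !zero_lfunE.
by rewrite !add_lfunE !scale_lfunE Hf Hg sact_linearr.
Qed.

HB.instance Definition _ := GRing.SubChoice_isSubLmodule.Build k _ _ salg_hom
  (GRing.submod_closed_semi salg_equivariant_submod).

End Hom.

Fact salg_hom_id_subproof (M : salg_module) :
  (\1 : 'Hom(M, M))%VF \in @salg_equivariant M M.
Proof. by apply/asboolP=> a v; rewrite !id_lfunE. Qed.

Definition salg_hom_id M : salg_hom M M := SalgHom (salg_hom_id_subproof M).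

Fact salg_hom_comp_subproof (M N P : salg_module)
    (g : salg_hom N P) (f : salg_hom M N) :
  (salg_hom_val g \o salg_hom_val f)%VF \in @salg_equivariant M P.
Proof.
have /asboolP Hg := valP g; have /asboolP Hf := valP f.
by apply/asboolP=> a v; rewrite !comp_lfunE Hf Hg.
Qed.

Definition salg_hom_comp M N P (g : salg_hom N P) (f : salg_hom M N) :
  salg_hom M P := SalgHom (salg_hom_comp_subproof g f).

Fact salg_hom_compA M N P Q
    (h : salg_hom P Q) (g : salg_hom N P) (f : salg_hom M N) :
  salg_hom_comp h (salg_hom_comp g f) = salg_hom_comp (salg_hom_comp h g) f.
Proof. by apply: val_inj; apply: comp_lfunA. Qed.

Fact salg_hom_comp1l M N (f : salg_hom M N) :
  salg_hom_comp (salg_hom_id N) f = f.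
Proof. by apply: val_inj; apply: comp_lfun1l. Qed.

Fact salg_hom_comp1r M N (f : salg_hom M N) :
  salg_hom_comp f (salg_hom_id M) = f.
Proof. by apply: val_inj; apply: comp_lfun1r. Qed.

Fact salg_hom_comp_linearl M N P (f : salg_hom M N) :
  linear (fun g : salg_hom N P => salg_hom_comp g f).
Proof.
move=> c g g'; apply: val_inj => /=.
by rewrite comp_lfunDl comp_lfunZl.
Qed.

Fact salg_hom_comp_linearr M N P (g : salg_hom N P) :
  linear (fun f : salg_hom M N => salg_hom_comp g f).
Proof.
move=> c f f'; apply: val_inj => /=.
by rewrite comp_lfunDr comp_lfunZr.
Qed.

End SemigroupAlgebra.

Section LkS.
Variables (k : fieldType) (S : finSemigroupType) (E : {set S}).
Hypotheses (idemE : set_of_idempotents E) (fountE : reduced_E_Fountain E).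

Definition Ltilde_class (e : S) : {set S} := [set x | Ltilde E x e].

(* The module with basis the class of e is determined by its basis, and
   represented by it: two objects of the category below are equal exactly when
   they are the same module. *)
Definition LkS_ob : Type :=
  {X : {set S} | X \in [set Ltilde_class e | e in E]}.

Section Module.
Variable X : LkS_ob.

Definition kL : vectType k := {ffun {x : S | x \in val X} -> k^o}.

Definition kL_act_basis (s : S) (x : {x : S | x \in val X}) : kL :=
  if insub (s * val x)%g is Some y then basis k y else 0.

Definition kL_act : salg k S -> kL -> kL := bilin_ext kL_act_basis.

Fact kL_mul_closed (s t x : S) :
  x \in val X -> (s * (t * x))%g \in val X -> (t * x)%g \in val X.
Proof.
have /imsetP[e eE ->] := valP X; rewrite !inE => /LtildeP/(_ e eE) xe stx.
apply: Ltilde_mull stx _ => //; rewrite -mulgA.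
by have [_ ->] := xe; rewrite // idemE.
Qed.

Fact kL_act_mul a b v : kL_act (salg_mul a b) v = kL_act a (kL_act b v).
Proof.
apply: bilin_extA => s t x; rewrite bilin_ext_basis /kL_act_basis -mulgA.
case: (@insubP _ _ {x : S | x \in val X} (t * val x)%g) => [y _ <-|tx].
  by rewrite bilin_ext_basis.
rewrite insubF; last first.
  by apply/negP=> /(kL_mul_closed (valP x)) tx'; rewrite tx' in tx.
have := bilin_ext_linearr kL_act_basis (basis k s) (-1) 0 0.
by rewrite scaler0 addr0 scaleN1r addNr => /esym.
Qed.

Definition kL_module : salg_module k S :=
  SalgModule (bilin_ext_linearl kL_act_basis) (bilin_ext_linearr kL_act_basis)
    kL_act_mul.

End Module.

Definition LkS : lincat k :=
  @LinCat k LkS_ob (fun X Y => salg_hom (kL_module X) (kL_module Y))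
    (fun X => salg_hom_id (kL_module X))
    (fun X Y Z g f => salg_hom_comp g f)
    (fun X Y Z T h g f => salg_hom_compA h g f)
    (fun X Y f => salg_hom_comp1l f) (fun X Y f => salg_hom_comp1r f)
    (fun X Y Z f => @salg_hom_comp_linearl k S _ _ _ f)
    (fun X Y Z g => @salg_hom_comp_linearr k S _ _ _ g).

End LkS.

(* Main.v *)
Require Import Defs.
From HB Require Import structures.
From mathcomp Require Import all_boot all_order all_algebra.
From mathcomp Require Import boolp.

Set Implicit Arguments.
Unset Strict Implicit.
Unset Printing Implicit Defensive.

Import GRing.Theory.
Local Open Scope ring_scope.

(** Write L(e) for the class of e and kL(e) for the module it spans.  The
    isomorphism sends e to kL(e), and a morphism C(a) with a^* = e and
    a^+ = f to right multiplication by a, which maps L(f) to L(e), hence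
    reverses arrows.

    That right multiplication by a is kS-linear says that s x leaves L(f)
    exactly when s x a leaves L(e).  The generalized right ample identity gives
    this: it implies that (s x)^* = x^* iff (s x^+)^* = x^+
    ([star_mul_plusE]), so that whether s kills a basis vector x depends on x^+
    only ([rtrans_equivariant]).

    A homomorphism h from kL(f) to kL(e) is determined by h(f), since x = x f on
    L(f).  As f a = a, right multiplication by a sends the basis vector f to the
    basis vector a, so the functor is faithful and hits exactly those h for
    which h(f) is supported on the x in L(e) with x^+ = f.  So it remains to see that every h has this support
    ([hom_support]).  Let c . x be c x if c^* = x^+ and 0 otherwise (the action
    of the category algebra).  By the equivalence above, s acts on kL(e) as the
    sum of the operators c . - over all c below s for the relation
    c = s c^* ([act_cat_act]).  As that relation is contained in a partial order
    on a finite set, this system is unitriangular, so by induction every h,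
    commuting with all s, commutes with all c . - ([hom_cat_act]).  Finally
    f . f = f, so h(f) = f . h(f), and the image of f . - is spanned by the x
    with x^+ = f. *)

(** * Bilinear extensions at basis vectors *)

Section FreeSpaces.
Variable k : fieldType.

Lemma bilin_ext_basisl (T1 T2 : finType) (V : lmodType k) (m : T1 -> T2 -> V)
    x (v : {ffun T2 -> k^o}) :
  bilin_ext m (basis k x) v = \sum_y (v y : k) *: m x y.
Proof.
rewrite [in LHS](basis_sum v) bilin_ext_sumr.
by apply: eq_bigr => y _; rewrite bilin_ext_basis.
Qed.

Lemma bilin_ext_basisr (T1 T2 : finType) (V : lmodType k) (m : T1 -> T2 -> V)
    (u : {ffun T1 -> k^o}) y :
  bilin_ext m u (basis k y) = \sum_x (u x : k) *: m x y.
Proof.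
rewrite [in LHS](basis_sum u) bilin_ext_suml.
by apply: eq_bigr => x _; rewrite bilin_ext_basis.
Qed.

Lemma bilin_ext0l (T1 T2 : finType) (V : lmodType k) (m : T1 -> T2 -> V) v :
  bilin_ext m 0 v = 0.
Proof.
rewrite /bilin_ext big1 // => x _; rewrite big1 // => y _.
by rewrite ffunE mul0r scale0r.
Qed.

End FreeSpaces.

(** * Consequences of the generalized right ample identity *)

Section Semigroup.
Variables (S : finSemigroupType) (E : {set S}).
Hypotheses (idemE : set_of_idempotents E) (fountE : reduced_E_Fountain E).
Hypothesis congE : congruence_condition E.
Local Open Scope group_scope.

Lemma mem_Ltilde_class e x :
  e \in E -> (x \in Ltilde_class E e) = (star E x == e).
Proof.
move=> eE; rewrite inE; apply/idP/eqP => [xe|<-].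
  by rewrite -(star_uniq idemE fountE eE xe).
by have [] := starP fountE x.
Qed.

Lemma star_mul_composable x a :
  star E x = plus E a -> star E (x * a) = star E a.
Proof. by move=> xa; rewrite starM // xa plus_mul. Qed.

Hypothesis grampleE : generalized_right_ample E.

(** The left-hand side says that s does not kill the basis vector x of its
    module.  The identity is used at a = x with the idempotents s^* and x^*:
    then (s^* x x^* )^* = (s x)^* = x^*, so it reads
    (s^* x^+)^* = x^+. *)
Lemma star_mul_plusE s x :
  (star E (s * x) == star E x) = (star E (s * plus E x) == plus E x).
Proof.
apply/eqP/eqP=> [sx|]; last first.
  by move=> /star_mul_composable; rewrite -mulgA plus_mul.
have [eE _] := starP fountE s; have [fE _] := starP fountE x.
have := grampleE x eE fE.
rewrite -mulgA mul_star // -(starM idemE fountE congE s x) sx mul_star //.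
by rewrite -starM.
Qed.

End Semigroup.

(** * The functor given by right multiplication *)

Section Functor.
Variables (k : fieldType) (S : finSemigroupType) (E : {set S}).
Hypotheses (idemE : set_of_idempotents E) (fountE : reduced_E_Fountain E).
Hypothesis congE : congruence_condition E.
Hypothesis grampleE : generalized_right_ample E.

Definition class_ob (e : CS_ob E) : LkS_ob E :=
  Sub (Ltilde_class E (val e)) (imset_f _ (valP e)).

Lemma class_ob_bij : bijective class_ob.
Proof.
have ex (X : LkS_ob E) : exists e : CS_ob E, class_ob e == X.
  have /imsetP[e eE Xe] := valP X.
  by exists (Sub e eE); apply/eqP/val_inj; rewrite /= -Xe.
exists (fun X => xchoose (ex X)) => [e|X]; last exact/eqP/(xchooseP (ex X)).
have /eqP/(congr1 val)/= ee' := xchooseP (ex (class_ob e)).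
apply: val_inj; move: (xchoose _) ee' => e' /setP/(_ (val e')).
rewrite !mem_Ltilde_class ?(valP e) ?(valP e') // star_id ?(valP e') //.
by rewrite eqxx => /esym/eqP.
Qed.

Local Notation elt X := {x : S | x \in val X}.

Lemma star_elt e (x : elt (class_ob e)) : star E (val x) = val e.
Proof.
by apply/eqP; rewrite -mem_Ltilde_class ?(valP x) ?(valP e).
Qed.

Lemma elt_mul_id e (x : elt (class_ob e)) : (val x * val e)%g = val x.
Proof. by have := mul_star idemE fountE (val x); rewrite star_elt. Qed.

Lemma id_mul_hom (e f : CS_ob E) (a : CS_hom e f) :
  (val f * val a)%g = val a.
Proof.
have /andP[_ /eqP pa] := valP a.
by have := plus_mul idemE fountE (val a); rewrite pa.
Qed.

Lemma star_eltE (X : LkS_ob E) (x : elt X) y :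
  (y \in val X) = (star E y == star E (val x)).
Proof.
have [cls _ clsK] := class_ob_bij; rewrite -(clsK X) in x *.
by rewrite star_elt mem_Ltilde_class //; apply: valP.
Qed.

Fact mul_hom_subproof e f (x : elt (class_ob f)) (a : CS_hom e f) :
  (val x * val a)%g \in val (class_ob e).
Proof.
have /andP[/eqP sa /eqP pa] := valP a.
by rewrite mem_Ltilde_class ?(valP e) // star_mul_composable ?sa ?star_elt ?pa.
Qed.

Definition mul_hom e f (x : elt (class_ob f)) (a : CS_hom e f) :
  elt (class_ob e) := Sub (val x * val a)%g (mul_hom_subproof x a).

Definition rtrans e f (u : {ffun CS_hom e f -> k^o}) :
    kL k (class_ob f) -> kL k (class_ob e) :=
  fun v => bilin_ext (fun x a => basis k (mul_hom x a)) v u.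

(** On basis vectors this is associativity of the product, once s x a is known
    to lie in the class of e exactly when s x lies in that of f.  As
    x^* = f = a^+, so that s x = s x a^+, the latter says (s x a^+)^* = a^+,
    which by [star_mul_plusE] is equivalent to the former, (s x a)^* = a^*. *)
Lemma rtrans_equivariant e f u a v :
  @rtrans e f u (kL_act a v) = kL_act a (rtrans u v).
Proof.
apply: bilin_extA => s x {}a; rewrite bilin_ext_basis /kL_act_basis.
have /andP[/eqP sa /eqP pa] := valP a.
have sxa : ((s * (val x * val a))%g \in val (class_ob e)) =
           ((s * val x)%g \in val (class_ob f)).
  rewrite (star_eltE (mul_hom x a)) (star_eltE x) /= star_elt mulgA.
  rewrite star_mul_composable ?star_elt ?pa // star_mul_plusE // pa -mulgA.
  by rewrite elt_mul_id.
case: insubP => [y sx yE|sx].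
  rewrite bilin_ext_basis insubT /= ?sxa // => h.
  by congr (basis k _); apply: val_inj; rewrite /= mulgA yE.
by rewrite bilin_ext0l insubF // [LHS]sxa; apply: negbTE.
Qed.

Section RtransHom.
Variables (e f : CS_ob E) (u : {ffun CS_hom e f -> k^o}).

HB.instance Definition _ :=
  GRing.isLinear.Build k (kL k (class_ob f)) (kL k (class_ob e)) _ (rtrans u)
    (bilin_ext_linearl _ u).

Fact rtrans_hom_subproof : linfun (rtrans u) \in
  @salg_equivariant k S (kL_module k idemE fountE (class_ob f))
    (kL_module k idemE fountE (class_ob e)).
Proof. by apply/asboolP=> a v; rewrite !lfunE; apply: rtrans_equivariant. Qed.

Definition rtrans_hom := SalgHom rtrans_hom_subproof.

Lemma rtrans_homE v : rtrans_hom v = rtrans u v.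
Proof. exact: lfunE. Qed.

End RtransHom.

Lemma rtrans_hom_linear e f : linear (@rtrans_hom e f).
Proof.
move=> c u u'; apply: val_inj; apply/lfunP=> v.
by rewrite add_lfunE scale_lfunE !rtrans_homE /rtrans bilin_ext_linearr.
Qed.

Lemma rtrans_hom_id e :
  rtrans_hom (basis k (CS_id idemE fountE e)) = salg_hom_id _.
Proof.
apply: val_inj; apply/lfunP=> v.
rewrite id_lfunE rtrans_homE /rtrans bilin_ext_basisr [RHS]basis_sum.
apply: eq_bigr => x _; congr (_ *: basis k _); apply: val_inj.
exact: elt_mul_id.
Qed.

Lemma rtrans_hom_comp e f g u u' :
  rtrans_hom (@lin_comp k (CS idemE fountE congE) e f g u u') =
  salg_hom_comp (rtrans_hom u') (rtrans_hom u).
Proof.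
apply: val_inj; apply/lfunP=> v.
rewrite comp_lfunE !rtrans_homE; apply/esym/bilin_extA => x a b.
rewrite !bilin_ext_basis; congr (basis k _).
by apply: val_inj; rewrite /= mulgA.
Qed.

Definition CS_functor :
  linfunctor (lop (linearization k (CS idemE fountE congE)))
             (LkS k idemE fountE) :=
  @LinFunctor k (lop (linearization k (CS idemE fountE congE)))
    (LkS k idemE fountE) class_ob (fun x y => @rtrans_hom y x)
    (fun x y => @rtrans_hom_linear y x) rtrans_hom_id
    (fun x y z g f => rtrans_hom_comp f g).

(** * Fullness *)

(** The action of the morphism C(c) on the morphism C(x) by composition in the
    category, with 0 when they are not composable; identifying the module of the
    class of e with the span of the morphisms of domain e makes it a module over
    the category algebra.  [kL_act_basis] is c x here, since
    (c x)^* = x^* whenever c^* = x^+. *)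
Definition cat_act_basis (X : LkS_ob E) (c : S) (x : elt X) : kL k X :=
  if star E c == plus E (val x) then kL_act_basis k c x else 0.

Definition cat_act X : salg k S -> kL k X -> kL k X :=
  bilin_ext (@cat_act_basis X).

(** At most one term is nonzero: c^* = x^+ and c = s c^* force c = s x^+, and
    this c qualifies iff (s x^+)^* = x^+, that is, iff s does not kill x. *)
Lemma act_cat_act_basis X s x :
  @kL_act_basis k S E X s x =
  \sum_(c | c == (s * star E c)%g) cat_act_basis c x.
Proof.
have [sx|sx] := eqVneq (star E (s * plus E (val x))%g) (plus E (val x)).
  rewrite (bigD1 (s * plus E (val x))%g) /= ?sx //.
  rewrite [X in _ + X]big1 => [|c /andP[/eqP cE cx]].
    by rewrite addr0 /cat_act_basis sx eqxx /kL_act_basis -mulgA plus_mul.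
  rewrite /cat_act_basis; case: eqP => // cp.
  by rewrite cE cp eqxx in cx.
rewrite /kL_act_basis insubF.
  rewrite big1 // => c /eqP cE; rewrite /cat_act_basis; case: eqP => // cp.
  by move: sx; rewrite -cp -cE eqxx.
by rewrite (star_eltE x) star_mul_plusE // (negbTE sx).
Qed.

Lemma act_cat_act X s (v : kL k X) :
  kL_act (basis k s) v =
  \sum_(c | c == (s * star E c)%g) cat_act (basis k c) v.
Proof.
under eq_bigr do rewrite /cat_act bilin_ext_basisl.
rewrite exchange_big /kL_act bilin_ext_basisl; apply: eq_bigr => x _.
by rewrite -scaler_sumr -act_cat_act_basis.
Qed.

Fact id_elt_subproof (e : CS_ob E) : val e \in val (class_ob e).
Proof. by rewrite inE Ltilde_refl. Qed.

Definition id_elt e : elt (class_ob e) := Sub (val e) (id_elt_subproof e).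

Hypothesis ordE : exists R : rel S,
  [/\ reflexive R, antisymmetric R, transitive R &
      forall a b : S, trianglelefteq_l E a b -> R a b].

(** Induction along the partial order: by [act_cat_act] the operator of c is the
    action of c in the semigroup algebra, which h respects, minus the operators
    of elements strictly below c. *)
Lemma hom_cat_act X Y
    (h : salg_hom (kL_module k idemE fountE X) (kL_module k idemE fountE Y))
    c v :
  h (cat_act (basis k c) v) = cat_act (basis k c) (h v).
Proof.
have [R [Rr Ra Rt RE]] := ordE.
have [n] := ubnP #|[set b | R b c]|; elim: n => // n IH in c v *.
rewrite ltnS => cn.
have diag Z (w : kL k Z) : cat_act (basis k c) w = kL_act (basis k c) w -
    \sum_(b | (b == c * star E b)%g && (b != c)) cat_act (basis k b) w.
  by rewrite act_cat_act (bigD1 c) /= ?mul_star // addrK.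
have /asboolP/(_ (basis k c) v) hc := valP h.
rewrite !diag linearB; congr (_ - _); first exact: hc.
rewrite linear_sum /=.
apply: eq_bigr => b /andP[/eqP bE bc]; apply: IH; apply: leq_trans cn.
have Rbc : R b c by apply: RE; exists (star E b) => //; case: (starP fountE b).
apply/proper_card/properP; split.
  by apply/subsetP=> a; rewrite !inE => ab; apply: Rt Rbc.
exists c; rewrite !inE //; apply: contra bc => Rcb.
by apply/eqP/Ra/andP.
Qed.

(** The identity C(e) fixes the basis vector e and kills every basis vector y
    with y^+ <> e; apply h to the first fact. *)
Lemma hom_support e (Y : LkS_ob E)
    (h : salg_hom (kL_module k idemE fountE (class_ob e))
                  (kL_module k idemE fountE Y)) (y : elt Y) :
  plus E (val y) != val e -> (h (basis k (id_elt e)) : kL k Y) y = 0.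
Proof.
move=> ye; have eE := valP e.
have fixe : cat_act (basis k (val e)) (basis k (id_elt e)) =
            basis k (id_elt e).
  rewrite /cat_act bilin_ext_basis /cat_act_basis /= star_id // plus_id //.
  by rewrite eqxx /kL_act_basis /= idemE // (valK (id_elt e)).
rewrite -fixe hom_cat_act /cat_act bilin_ext_basisl sum_ffunE big1 // => x _.
rewrite ffunE /cat_act_basis star_id //; case: eqP => [ex|_].
  rewrite /kL_act_basis ex plus_mul // valK ffunE.
  by case: eqP => [yx|_]; rewrite ?scaler0 //; rewrite yx -ex eqxx in ye.
by rewrite ffunE scaler0.
Qed.

(** The basis vector e generates the module, because x e = x on the class. *)
Lemma hom_eq_id_elt e (N : salg_module k S)
    (h h' : salg_hom (kL_module k idemE fountE (class_ob e)) N) :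
  h (basis k (id_elt e)) = h' (basis k (id_elt e)) -> h = h'.
Proof.
move=> hh'; apply: val_inj; apply/lfunP=> v; rewrite [v]basis_sum.
rewrite !linear_sum; apply: eq_bigr => x _; rewrite !linearZ /=.
congr (_ *: _).
have -> : basis k x = kL_act (basis k (val x)) (basis k (id_elt e)).
  rewrite /kL_act bilin_ext_basis /kL_act_basis /=.
  by rewrite elt_mul_id valK.
have /asboolP H := valP h; have /asboolP H' := valP h'.
by rewrite [LHS]H [RHS]H' hh'.
Qed.

(** Since f a = a, the coordinates of u can be read off the image of f. *)
Lemma rtrans_id_elt e f (u : {ffun CS_hom e f -> k^o}) a :
  rtrans u (basis k (id_elt f)) (mul_hom (id_elt f) a) = u a.
Proof.
rewrite /rtrans bilin_ext_basisl sum_ffunE (bigD1 a) //= big1 => [|b ba].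
  by rewrite !ffunE eqxx addr0 /GRing.scale /= mulr1.
rewrite !ffunE; case: eqP => [/(congr1 val)/= ab|_]; last exact: scaler0.
by case/eqP: ba; apply: val_inj; move: ab; rewrite !id_mul_hom.
Qed.

(** The inverse reads off the coordinates of h(f).  It recovers all of h(f)
    because both h and the right multiplication so obtained have the support
    given by [hom_support]. *)
Lemma rtrans_hom_bij e f : bijective (@rtrans_hom e f).
Proof.
pose coefs (h : salg_hom (kL_module k idemE fountE (class_ob f))
                         (kL_module k idemE fountE (class_ob e))) :=
  [ffun a : CS_hom e f =>
    (h (basis k (id_elt f)) : kL k (class_ob e)) (mul_hom (id_elt f) a) : k^o].
have coefsK u : coefs (rtrans_hom u) = u.
  by apply/ffunP=> a; rewrite ffunE rtrans_homE rtrans_id_elt.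
exists coefs => // h; apply: hom_eq_id_elt; apply/ffunP=> y.
have [yf|yf] := eqVneq (plus E (val y)) (val f); last by rewrite !hom_support.
have aP : (star E (val y) == val e) && (plus E (val y) == val f).
  by rewrite star_elt yf !eqxx.
have -> : y = mul_hom (id_elt f) (Sub (val y) aP : CS_hom e f).
  by apply: val_inj; rewrite /= -yf plus_mul.
by have /ffunP/(_ (Sub (val y) aP)) := coefsK (coefs h); rewrite !ffunE.
Qed.

End Functor.

Theorem theorem3p13 (k : fieldType) (S : finSemigroupType) (E : {set S})
    (idemE : set_of_idempotents E)
    (fountE : reduced_E_Fountain E)
    (congE : congruence_condition E)
    (grampleE : generalized_right_ample E)
    (ordE : exists R : rel S, [/\ reflexive R, antisymmetric R, transitive R &
             forall a b : S, trianglelefteq_l E a b -> R a b]) :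
  lincat_iso (lop (linearization k (CS idemE fountE congE))) (LkS k idemE fountE).
Proof.
exists (CS_functor k idemE fountE congE grampleE); split.
  exact: class_ob_bij.
by move=> x y; apply: rtrans_hom_bij.
Qed.
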